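(* Let $\alpha,\beta\in\mathbb{C}_p\setminus\{0\}$ be such that $\rho(\alpha^d)\neq\rho(\beta^d)$. Then $T(\alpha)\cap T(\beta)=\emptyset$, i.e. there is no $\lambda\in\mathbb{C}_p$ for which $\alpha$ and $\beta$ are both preperiodic for $f_\lambda$.
   Context: Let $p$ be a prime and $d\ge2$ an integer. $\mathbb{C}_p$ is the completion of $\overline{\mathbb{Q}_p}$ with $p$-adic absolute value $|\cdot|_p$, $|p|_p=\frac1p$; $\rho:\mathbb{P}^1(\mathbb{C}_p)\to\mathbb{P}^1(\overline{\mathbb{F}_p})$ is the natural reduction map. For $\lambda\in\mathbb{C}_p$, $f_\lambda(z)=\frac{z^d+\lambda}{pz}$ acting on $\mathbb{P}^1(\mathbb{C}_p)$, and $T(\alpha)=\{\lambda\in\mathbb{C}_p:\alpha\text{ is preperiodic for }f_\lambda\}$. *)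

(* Defs.v *)
From mathcomp Require Import all_boot all_order all_algebra.
From mathcomp Require Import classical_sets reals.

Set Implicit Arguments.
Unset Strict Implicit.
Unset Printing Implicit Defensive.

Import Order.TTheory GRing.Theory Num.Theory.
Local Open Scope ring_scope.

Definition padic_abs (R : realType) (p : nat) (x : rat) : R :=
  if x == 0 then 0
  else p%:R ^ ((logn p `|denq x|)%:Z - (logn p `|numq x|)%:Z).

Record nonarch_absval (R : realType) (K : fieldType) (v : K -> R) : Prop := {
  absval_ge0 : forall x, 0 <= v x;
  absval_eq0 : forall x, v x = 0 <-> x = 0;
  absvalM : forall x y, v (x * y) = v x * v y;
  absvalD : forall x y, v (x + y) <= Num.max (v x) (v y)
}.

Definition isometric (R : realType) (K L : fieldType) (vK : K -> R)
    (vL : L -> R) (i : K -> L) : Prop :=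
  forall x, vL (i x) = vK x.

Definition dense_image (R : realType) (K L : fieldType) (vL : L -> R)
    (i : K -> L) : Prop :=
  forall (y : L) (e : R), 0 < e -> exists x : K, vL (y - i x) < e.

Definition cauchy_complete (R : realType) (L : fieldType) (v : L -> R) : Prop :=
  forall u : nat -> L,
    (forall e : R, 0 < e -> exists N : nat,
       forall m n : nat, (N <= m)%N -> (N <= n)%N -> v (u m - u n) < e) ->
    exists l : L, forall e : R, 0 < e -> exists N : nat,
      forall n : nat, (N <= n)%N -> v (u n - l) < e.

Record is_completion (R : realType) (K L : fieldType) (vK : K -> R)
    (vL : L -> R) (i : {rmorphism K -> L}) : Prop := {
  completion_absval : nonarch_absval vL;
  completion_isometric : isometric vK vL i;
  completion_dense : dense_image vL i;
  completion_complete : cauchy_complete vL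
}.

Record is_algebraic_closure (K L : fieldType) (i : {rmorphism K -> L}) : Prop := {
  algebraic_closure_algebraic : forall y : L, algebraicOver i y;
  algebraic_closure_closed : GRing.closed_field_axiom L
}.

(* The libraries have no p-adic fields, so C_p is given by its construction,
     Q --completion--> Q_p --algebraic closure--> Qbar_p --completion--> C_p.
   Each step determines the next field with its absolute value up to
   isometric isomorphism; in particular the absolute value of Qbar_p is the
   only one that extends the absolute value of Q_p. *)
Record padicComplex (R : realType) (p : nat) := PadicComplex {
  Qp : fieldType;
  Qp_abs : Qp -> R;
  Qp_inj : {rmorphism rat -> Qp};
  Qp_completion : is_completion (@padic_abs R p) Qp_abs Qp_inj;
  Qpbar : fieldType;
  Qpbar_abs : Qpbar -> R;
  Qpbar_inj : {rmorphism Qp -> Qpbar};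
  Qpbar_closure : is_algebraic_closure Qpbar_inj;
  Qpbar_absval : nonarch_absval Qpbar_abs;
  Qpbar_isometric : isometric Qp_abs Qpbar_abs Qpbar_inj;
  Cp :> fieldType;
  Cp_abs : Cp -> R;
  Cp_inj : {rmorphism Qpbar -> Cp};
  Cp_completion : is_completion Qpbar_abs Cp_abs Cp_inj
}.

(* The residue field O/m of C_p, identified with an algebraic closure of F_p.
   [red] is the quotient map O -> O/m on O = {x : |x| <= 1}; its values
   outside O are arbitrary and never used. *)
Record residueMap (R : realType) (p : nat) (C : padicComplex R p) :=
  ResidueMap {
  Fpbar : fieldType;
  Fpbar_inj : {rmorphism 'F_p -> Fpbar};
  Fpbar_closure : is_algebraic_closure Fpbar_inj;
  red :> C -> Fpbar;
  red1 : red 1 = 1;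
  redD : forall x y : C, Cp_abs x <= 1 -> Cp_abs y <= 1 ->
    red (x + y) = red x + red y;
  redM : forall x y : C, Cp_abs x <= 1 -> Cp_abs y <= 1 ->
    red (x * y) = red x * red y;
  red_ker : forall x : C, Cp_abs x <= 1 -> (red x = 0 <-> Cp_abs x < 1);
  red_surj : forall a : Fpbar, exists2 x : C, Cp_abs x <= 1 & red x = a
}.

Variant P1 (K : Type) : Type := P1_fin of K | P1_inf.
Arguments P1_inf {K}.

Definition rho (R : realType) (p : nat) (C : padicComplex R p)
    (r : residueMap C) (z : P1 C) : P1 (Fpbar r) :=
  match z with
  | P1_fin x => if Cp_abs x <= 1 then P1_fin (r x) else P1_inf
  | P1_inf => P1_inf
  end.

(* The action of P/Q on the projective line. Common factors are removed
   first, so that for instance f_0(z) = z^(d-1)/p fixes 0; the value at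
   infinity is read off from the coefficients of degree max(deg P, deg Q)
   of the reduced fraction. *)
Definition ratmap (K : fieldType) (P Q : {poly K}) (z : P1 K) : P1 K :=
  let P0 := P %/ gcdp P Q in
  let Q0 := Q %/ gcdp P Q in
  let n := (maxn (size P0) (size Q0)).-1 in
  let quo (a b : K) := if b == 0 then P1_inf else P1_fin (a / b) in
  match z with
  | P1_fin x => quo P0.[x] Q0.[x]
  | P1_inf => quo P0`_n Q0`_n
  end.

Definition preperiodic (T : Type) (f : T -> T) (x : T) : Prop :=
  exists m n : nat, (m < n)%N /\ iter m f x = iter n f x.

Definition f_ (K : fieldType) (p d : nat) (lam : K) : P1 K -> P1 K :=
  ratmap ('X^d + lam%:P) (p%:R *: 'X).

Definition T_ (K : fieldType) (p d : nat) (alpha : K) : set K :=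
  [set lam | preperiodic (f_ p d lam) (P1_fin alpha)]%classic.

(* Main.v *)
(** The parameter determines the reduction of a preperiodic point: if a nonzero
    [a] is preperiodic for [f_lam], then [rho (a ^+ d) = rho (- lam)], and the
    right-hand side does not depend on [a].

    On the region [1 <= |z|], [|lam| < |z| ^ d] one has
    [|f_lam z| = p |z| ^ (d - 1)], so the region is mapped into itself and the
    absolute value strictly increases: it contains no preperiodic point. If
    [|a| <= 1], then [|f_lam a| >= p |a ^ d + lam|], so [f_lam a] lies in that
    region as soon as [|a ^ d + lam| >= max 1 |lam|]. Excluding both
    possibilities leaves only the cases [|lam| > 1], [|a| > 1] and
    [|lam| <= 1], [|a| <= 1], [|a ^ d + lam| < 1]. *)
Require Import Defs.
From mathcomp Require Import all_boot all_order all_algebra.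
From mathcomp Require Import classical_sets reals.

Set Implicit Arguments.
Unset Strict Implicit.
Unset Printing Implicit Defensive.

Import Order.TTheory GRing.Theory Num.Theory.
Local Open Scope ring_scope.

Lemma preperiodic_image (T : Type) (f : T -> T) (x : T) :
  preperiodic f x -> preperiodic f (f x).
Proof.
by move=> [m [n [lt_mn e]]]; exists m, n; rewrite -!iterSr !iterS e.
Qed.

(** The height [h] strictly increases along the orbit of [x], so no two iterates coincide. *)
Lemma increasing_not_preperiodic (R : realType) (T : Type) (f : T -> T)
    (E : T -> Prop) (h : T -> R) (x : T) :
  (forall y, E y -> E (f y) /\ h y < h (f y)) -> E x -> ~ preperiodic f x.
Proof.
move=> Ef Ex [m [n [lt_mn e]]].
have Ei k : E (iter k f x) by elim: k => //= k /Ef[].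
have: {homo (fun k => h (iter k f x)) : i j / (i < j)%N >-> i < j}.
  by apply: homo_ltn => [|k]; [exact: lt_trans | have [] := Ef _ (Ei k)].
by move=> /(_ _ _ lt_mn); rewrite e ltxx.
Qed.

(** The gcd divides [Q], so it does not vanish at [x] and cancels from the quotient of values. *)
Lemma ratmap_fin (K : fieldType) (P Q : {poly K}) (x : K) :
  Q.[x] != 0 -> ratmap P Q (P1_fin x) = P1_fin (P.[x] / Q.[x]).
Proof.
move=> Qx; rewrite /ratmap.
have eP : P.[x] = (P %/ gcdp P Q).[x] * (gcdp P Q).[x].
  by rewrite -hornerM divpK // dvdp_gcdl.
have eQ : Q.[x] = (Q %/ gcdp P Q).[x] * (gcdp P Q).[x].
  by rewrite -hornerM divpK // dvdp_gcdr.
move: Qx; rewrite {}eP {}eQ mulf_eq0 negb_or => /andP[Q0x gx].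
by rewrite (negPf Q0x) -mulf_div divff // mulr1.
Qed.

Lemma f_fin (K : fieldType) (p d : nat) (lam z : K) :
  p%:R != 0 :> K -> z != 0 ->
  f_ p d lam (P1_fin z) = P1_fin ((z ^+ d + lam) / (p%:R * z)).
Proof.
move=> p0 z0; have Qz : (p%:R *: 'X : {poly K}).[z] = p%:R * z.
  by rewrite hornerZ hornerX.
rewrite /f_ ratmap_fin Qz ?mulf_neq0 //.
by rewrite hornerD hornerXn hornerC.
Qed.

Section NonarchimedeanAbsoluteValue.

Variables (R : realType) (K : fieldType) (v : K -> R).
Hypothesis v_abs : nonarch_absval v.

Lemma absval_gt0 x : (0 < v x) = (x != 0).
Proof.
rewrite lt_neqAle (absval_ge0 v_abs) andbT eq_sym; congr (~~ _).
by apply/eqP/eqP => /(absval_eq0 v_abs).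
Qed.

Lemma absval1 : v 1 = 1.
Proof.
have v1 : v 1 != 0 by rewrite gt_eqF // absval_gt0 oner_neq0.
by apply: (mulfI v1); rewrite -(absvalM v_abs) !mulr1.
Qed.

Lemma absvalX x n : v (x ^+ n) = v x ^+ n.
Proof.
elim: n => [|n IHn]; first by rewrite !expr0 absval1.
by rewrite !exprS (absvalM v_abs) IHn.
Qed.

Lemma absvalN x : v (- x) = v x.
Proof.
suff vN1 : v (-1) = 1 by rewrite -mulN1r (absvalM v_abs) vN1 mul1r.
apply/eqP; rewrite -(@eqrXn2 _ 2) ?(absval_ge0 v_abs) //.
by rewrite -absvalX sqrrN !expr1n absval1.
Qed.

Lemma absval_div x y : y != 0 -> v (x / y) = v x / v y.
Proof.
rewrite -absval_gt0 => /lt0r_neq0 vy; apply: (mulIf vy).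
rewrite divfK // -(absvalM v_abs) divfK //.
by apply: contra_neq vy => ->; apply/(absval_eq0 v_abs).
Qed.

Lemma absval_dominant x y : v y < v x -> v (x + y) = v x.
Proof.
move=> lt_yx; apply/le_anti/andP; split.
  by rewrite (le_trans (absvalD v_abs x y)) // ge_max lexx ltW.
(* Apply the ultrametric inequality to [x = (x + y) - y]: the maximum cannot be [v y]. *)
have := absvalD v_abs (x + y) (- y); rewrite addrK absvalN le_max.
by rewrite (leNgt _ (v y)) lt_yx orbF.
Qed.

Variables (p d : nat) (lam : K).
Hypotheses (p_gt1 : (1 < p)%N) (d_gt1 : (1 < d)%N).
Hypothesis v_p : v p%:R = p%:R^-1.

Let p_neq0 : p%:R != 0 :> K.
Proof. by rewrite -absval_gt0 v_p invr_gt0 ltr0n ltnW. Qed.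

Let p_gt1R : 1 < p%:R :> R.
Proof. by rewrite ltr1n. Qed.

Let f_absval z : z != 0 ->
  v ((z ^+ d + lam) / (p%:R * z)) = p%:R * v (z ^+ d + lam) / v z.
Proof.
move=> z0; rewrite absval_div ?mulf_neq0 // (absvalM v_abs) v_p.
by rewrite invfM invrK mulrA (mulrC _ p%:R).
Qed.

(** Infinity must be left out: since [1 < d], it is a fixed point of [f_ p d lam]. *)
Definition escaping (z : P1 K) : Prop :=
  if z is P1_fin x then 1 <= v x /\ v lam < v x ^+ d else False.

Lemma escaping_not_preperiodic z : escaping z -> ~ preperiodic (f_ p d lam) z.
Proof.
pose h (z : P1 K) := if z is P1_fin x then v x else 0.
apply: (increasing_not_preperiodic (h := h)) => {z} [[z|//]] [z_ge1 z_lam].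
have z_gt0 : 0 < v z by exact: lt_le_trans z_ge1.
have z0 : z != 0 by rewrite -absval_gt0.
rewrite f_fin // /escaping /h f_absval // absval_dominant ?absvalX //.
(* Here [v z ^+ 2 <= v z ^+ d] because [1 <= v z] and [2 <= d]; the factor [p] makes the inequality
   strict. *)
have lt_z : v z < p%:R * v z ^+ d / v z.
  rewrite ltr_pdivlMr // -expr2 (@le_lt_trans _ _ (v z ^+ d)) //.
    by rewrite ler_weXn2l.
  by rewrite ltr_pMl // exprn_gt0.
split=> //; split; first exact: le_trans (ltW lt_z).
by rewrite (lt_le_trans z_lam) // lerXn2r ?nnegrE ?ltW // (lt_trans z_gt0).
Qed.

Lemma image_not_preperiodic a : a != 0 -> v a <= 1 ->
  1 <= v (a ^+ d + lam) -> v lam <= v (a ^+ d + lam) ->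
  ~ preperiodic (f_ p d lam) (P1_fin a).
Proof.
move=> a0 a_le1; set s := v _ => s_ge1 lam_s prea.
apply: escaping_not_preperiodic (preperiodic_image prea).
rewrite f_fin // /escaping f_absval // -/s.
have a_gt0 : 0 < v a by rewrite absval_gt0.
have s_gt0 : 0 < s by exact: lt_le_trans s_ge1.
have s_lt : s < p%:R * s / v a.
  rewrite ltr_pdivlMr // (@le_lt_trans _ _ s) ?ltr_pMl //.
  by rewrite ler_piMr // ltW.
have w_ge1 : 1 <= p%:R * s / v a by rewrite (le_trans s_ge1) // ltW.
(* With [w = p%:R * s / v a], the chain is [v lam <= s < w <= w ^+ d], the last step by [1 <= w]. *)
split=> //; apply: le_lt_trans lam_s (lt_le_trans s_lt _).
by rewrite ler_eXnr // ltnW.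
Qed.

(** The branches are the two ways in which [a ^+ d] and [- lam] can have the same reduction: both
    are integral and their difference lies in the maximal ideal, or both reduce to infinity. *)
Lemma preperiodic_reduction a : a != 0 ->
  preperiodic (f_ p d lam) (P1_fin a) ->
  if v lam <= 1 then v (a ^+ d) <= 1 /\ v (a ^+ d + lam) < 1
  else 1 < v (a ^+ d).
Proof.
move=> a0 prea.
have d_gt0 : (0 < d)%N by exact: ltnW.
have v_a : v (a ^+ d) <= 1 = (v a <= 1).
  by rewrite absvalX expr_le1 // (absval_ge0 v_abs).
case: (leP (v lam) 1) => [lam_le1|lam_gt1].
  have a_le1 : v a <= 1.
    rewrite leNgt; apply/negP => a_gt1.
    case: (@escaping_not_preperiodic _ _ prea); split; first exact: ltW.
    by rewrite (le_lt_trans lam_le1) // exprn_egt1 // -lt0n.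
  rewrite v_a; split=> //; rewrite ltNge; apply/negP => s_ge1.
  exact: image_not_preperiodic (le_trans lam_le1 s_ge1) prea.
rewrite ltNge; apply/negP => ad_le1.
(* If [a ^+ d] were integral, [lam] would dominate the sum, and the image of [a] would escape. *)
have s_lam : v (a ^+ d + lam) = v lam.
  by rewrite addrC absval_dominant // (le_lt_trans ad_le1).
apply: (image_not_preperiodic a0 _ _ _ prea); rewrite -?v_a ?s_lam //.
exact: ltW.
Qed.

End NonarchimedeanAbsoluteValue.

Lemma padic_abs_p (R : realType) (p : nat) :
  prime p -> padic_abs R p p%:R = p%:R^-1.
Proof.
move=> p_pr; have p0 : p%:R != 0 :> rat by rewrite pnatr_eq0 -lt0n prime_gt0.
rewrite /padic_abs (negPf p0) (pmulrn (1 : rat)) numq_int denq_int.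
by rewrite /= logn1 sub0r logn_prime // eqxx exprN1.
Qed.

(** The three embeddings are isometric and preserve natural numbers, so the value is the one on the
    rationals. *)
Lemma Cp_abs_p (R : realType) (p : nat) (C : padicComplex R p) :
  prime p -> Cp_abs (p%:R : C) = p%:R^-1.
Proof.
move=> p_pr; rewrite -(rmorph_nat (@Cp_inj R p C)).
rewrite (completion_isometric (Cp_completion C)).
rewrite -(rmorph_nat (@Qpbar_inj R p C)) Qpbar_isometric.
rewrite -(rmorph_nat (@Qp_inj R p C)).
by rewrite (completion_isometric (Qp_completion C)) padic_abs_p.
Qed.

Lemma preperiodic_rho (R : realType) (p d : nat) (C : padicComplex R p)
    (r : residueMap C) (lam a : C) : prime p -> (1 < d)%N -> a != 0 ->
  preperiodic (f_ p d lam) (P1_fin a) ->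
  rho r (P1_fin (a ^+ d)) = rho r (P1_fin (- lam)).
Proof.
move=> p_pr d_gt1 a0 prea; have v_abs := completion_absval (Cp_completion C).
have v_p := Cp_abs_p C p_pr.
have := preperiodic_reduction v_abs (prime_gt1 p_pr) d_gt1 v_p a0 prea.
rewrite /rho absvalN //; case: (leP (Cp_abs lam) 1) => [lam_le1|_].
  move=> [-> s_lt1]; congr P1_fin.
  (* Split [a ^+ d] as [(a ^+ d + lam) - lam]; the first summand reduces to [0]. *)
  rewrite -[a ^+ d in LHS](addrK lam) redD ?absvalN ?(ltW s_lt1) //.
  by rewrite ((red_ker r (ltW s_lt1)).2 s_lt1) add0r.
by rewrite ltNge => /negPf ->.
Qed.

Theorem theorem5p2 (R : realType) (p : nat) (hp : prime p)
    (d : nat) (hd : (2 <= d)%N)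
    (C : padicComplex R p) (r : residueMap C)
    (alpha beta : C) (halpha : alpha <> 0) (hbeta : beta <> 0)
    (hrho : rho r (P1_fin (alpha ^+ d)) <> rho r (P1_fin (beta ^+ d))) :
  (T_ p d alpha `&` T_ p d beta = set0)%classic.
Proof.
rewrite -subset0 => lam [prea preb]; apply: hrho.
rewrite (preperiodic_rho r hp hd _ prea); last exact/eqP.
by rewrite (preperiodic_rho r hp hd _ preb) //; exact/eqP.
Qed.
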